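(* Let $(\mathcal{L},\omega_{\mathcal{L}})$ be a P-manifold of degree $n$ and let $(T^*[n+1]\mathcal{L},\omega,\Theta)$ be its canonical QP realization, with natural projection $\pi:T^*[n+1]\mathcal{L}\to\mathcal{L}$. Let $\Theta'$ be a function of degree $n+2$ on $T^*[n+1]\mathcal{L}$ and $\alpha_{\mathcal{L}}$ a function of degree $n+1$ on $\mathcal{L}$, with $\alpha=\pi^*\alpha_{\mathcal{L}}$, such that 1. $\{\Theta,\Theta'\}+\frac12\{\Theta',\Theta'\}=0$; 2. $\{\{\pi^*f,\Theta'\},\pi^*g\}|_{\mathcal{L}}=0$ for all $f,g\in C^\infty(\mathcal{L})$; 3. $e^{\delta_\alpha}(\Theta+\Theta')|_{\mathcal{L}}=0$. Then $(\mathcal{L},\omega_{\mathcal{L}},\alpha_{\mathcal{L}})$ is a twisted QP manifold.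
   Context: An N-manifold is a nonnegatively graded manifold. A P-manifold of degree $m$ is an N-manifold with a graded symplectic form of degree $m$; its graded Poisson bracket on functions has degree $-m$ and satisfies $\{f,g\}=-(-1)^{(|f|-m)(|g|-m)}\{g,f\}$. A QP manifold of degree $m$ is a P-manifold of degree $m$ together with a function $\Theta$ of degree $m+1$ with $\{\Theta,\Theta\}=0$. For an N-manifold $\mathcal{L}$ of degree $n$, the shifted cotangent bundle $T^*[n+1]\mathcal{L}$ with natural projection $\pi$ is considered with a graded symplectic form of degree $n+1$ for which the zero section $\mathcal{L}$ is Lagrangian; $\{-,-\}$ is its Poisson bracket and $|_{\mathcal{L}}$ is restriction to the zero section. For $\alpha$ of degree $n+1$ on $T^*[n+1]\mathcal{L}$, set $e^{\delta_\alpha}F=F+\{F,\alpha\}+\frac12\{\{F,\alpha\},\alpha\}+\cdots$. Twisted QP manifold: a triple $(\mathcal{L},\{-,-\}_{\mathcal{L}},\alpha_{\mathcal{L}})$ (equivalently $(\mathcal{L},\omega_{\mathcal{L}},\alpha_{\mathcal{L}})$, where $\{-,-\}_{\mathcal{L}}$ is the Poisson bracket of $\omega_{\mathcal{L}}$), where $(\mathcal{L},\{-,-\}_{\mathcal{L}})$ is a P-manifold of degree $n$ and $\alpha_{\mathcal{L}}\in C^\infty(\mathcal{L})$ has degree $n+1$, such that there exists a QP manifold $(T^*[n+1]\mathcal{L},\{-,-\},\Theta_1)$ of degree $n+1$ with (i) $\{f,g\}_{\mathcal{L}}=\{\{\pi^*f,\Theta_1\},\pi^*g\}|_{\mathcal{L}}$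 for all $f,g\in C^\infty(\mathcal{L})$, and (ii) $e^{\delta_\alpha}\Theta_1|_{\mathcal{L}}=0$, where $\alpha=\pi^*\alpha_{\mathcal{L}}$. Canonical QP realization of a P-manifold $(\mathcal{L},\omega_{\mathcal{L}})$ of degree $n$: $T^*[n+1]\mathcal{L}$ with its canonical symplectic form $\omega=\omega_{can}$ of degree $n+1$, and $\Theta$ the function of degree $n+2$, quadratic in the fibre coordinates, that corresponds to the Poisson bivector field of $\omega_{\mathcal{L}}$ under the identification of bivector fields on $\mathcal{L}$ with fibrewise quadratic functions on $T^*[n+1]\mathcal{L}$; it satisfies $\{\Theta,\Theta\}=0$ and $\{f,g\}_{\mathcal{L}}=\{\{\pi^*f,\Theta\},\pi^*g\}|_{\mathcal{L}}$ for all $f,g\in C^\infty(\mathcal{L})$. *)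

(* Defs.v *)
From HB Require Import structures.
From mathcomp Require Import all_boot all_order all_algebra.
From mathcomp Require Import all_classical all_reals all_analysis.
Set Implicit Arguments.
Unset Strict Implicit.
Unset Printing Implicit Defensive.
Import Order.TTheory GRing.Theory Num.Theory.
Import numFieldNormedType.Exports.
Local Open Scope classical_set_scope.
Local Open Scope ring_scope.

(* Graded manifolds as ringed spaces: a topological space M with a sheaf of
   nonnegatively graded, graded-commutative R-algebras that is locally
   isomorphic to C^oo(V) (x) Sym(xi_1, ..., xi_k), V open in R^d, deg xi_j > 0.
   Everything about a sheaf is only meaningful on open sets.                  *)

Definition smooth_on (R : realType) (d : nat) (V : set 'rV[R]_d)
    (g : 'rV[R]_d -> R) : Prop :=
  forall (s : seq 'I_d) (y : 'rV[R]_d), V y ->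
    differentiable
      (foldr (fun i (h : 'rV[R]_d -> R) => fun z => 'D_(delta_mx 0 i) h z) g s)
      y.

(* The rings are pzRingType because the sections over the empty set form the
   zero ring; the R-algebra structure is the map gs_cst.  gs_ev f p is the value
   at the point p of the degree-0 part of f.                                  *)
Record gsheaf (R : realType) (M : topologicalType) := GSheaf {
  gs_ring :> set M -> pzRingType;
  gs_cst : forall U, R -> gs_ring U;
  gs_hom : forall U, nat -> gs_ring U -> Prop;
  gs_res : forall U W, gs_ring U -> gs_ring W;
  gs_ev : forall U, gs_ring U -> M -> R;
  gs_cst1 : forall U, open U -> gs_cst U 1 = 1;
  gs_cstB : forall U a b, open U -> gs_cst U (a - b) = gs_cst U a - gs_cst U b;
  gs_cstM : forall U a b, open U -> gs_cst U (a * b) = gs_cst U a * gs_cst U b;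
  gs_cst_hom : forall U a, open U -> gs_hom 0 (gs_cst U a);
  gs_hom0 : forall U k, open U -> gs_hom k (0 : gs_ring U);
  gs_homB : forall U k (f g : gs_ring U), open U ->
    gs_hom k f -> gs_hom k g -> gs_hom k (f - g);
  gs_homM : forall U i j (f g : gs_ring U), open U ->
    gs_hom i f -> gs_hom j g -> gs_hom (i + j) (f * g);
  gs_koszul : forall U i j (f g : gs_ring U), open U ->
    gs_hom i f -> gs_hom j g -> f * g = (-1) ^+ (i * j) * (g * f);
  gs_decomp : forall U (f : gs_ring U), open U ->
    exists N (F : nat -> gs_ring U),
      (forall k, gs_hom k (F k)) /\ f = \sum_(k < N) F k;
  gs_direct : forall U N (F : nat -> gs_ring U), open U ->
    (forall k, gs_hom k (F k)) -> \sum_(k < N) F k = 0 ->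
    forall k, (k < N)%N -> F k = 0;
  gs_res1 : forall U W, open U -> open W -> W `<=` U ->
    gs_res W (1 : gs_ring U) = 1;
  gs_resB : forall U W (f g : gs_ring U), open U -> open W -> W `<=` U ->
    gs_res W (f - g) = gs_res W f - gs_res W g;
  gs_resM : forall U W (f g : gs_ring U), open U -> open W -> W `<=` U ->
    gs_res W (f * g) = gs_res W f * gs_res W g;
  gs_res_cst : forall U W a, open U -> open W -> W `<=` U ->
    gs_res W (gs_cst U a) = gs_cst W a;
  gs_res_hom : forall U W k (f : gs_ring U), open U -> open W -> W `<=` U ->
    gs_hom k f -> gs_hom k (gs_res W f);
  gs_res_id : forall U (f : gs_ring U), open U -> gs_res U f = f;
  gs_res_comp : forall U V W (f : gs_ring U), open U -> open V -> open W ->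
    W `<=` V -> V `<=` U -> gs_res W (gs_res V f) = gs_res W f;
  gs_local : forall (F : set (set M)) k
      (f : gs_ring (\bigcup_(V in F) V)),
    (forall V, F V -> open V) -> gs_hom k f ->
    (forall V, F V -> gs_res V f = 0) -> f = 0;
  gs_glue : forall (F : set (set M)) k (s : forall V, gs_ring V),
    (forall V, F V -> open V) -> (forall V, F V -> gs_hom k (s V)) ->
    (forall V V', F V -> F V' ->
      gs_res (V `&` V') (s V) = gs_res (V `&` V') (s V')) ->
    exists f : gs_ring (\bigcup_(V in F) V),
      gs_hom k f /\ forall V, F V -> gs_res V f = s V;
  gs_evB : forall U (f g : gs_ring U) p, open U -> U p ->
    gs_ev (f - g) p = gs_ev f p - gs_ev g p;
  gs_evM : forall U (f g : gs_ring U) p, open U -> U p ->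
    gs_ev (f * g) p = gs_ev f p * gs_ev g p;
  gs_ev_cst : forall U a p, open U -> U p -> gs_ev (gs_cst U a) p = a;
  gs_ev_pos : forall U k (f : gs_ring U) p, open U -> U p ->
    (0 < k)%N -> gs_hom k f -> gs_ev f p = 0;
  gs_ev_res : forall U W (f : gs_ring U) p, open U -> open W -> W `<=` U ->
    W p -> gs_ev (gs_res W f) p = gs_ev f p
}.

Section GradedManifolds.
Variables (R : realType) (M : topologicalType).
Implicit Types A : gsheaf R M.

(* Homogeneity of integer degree: there is nothing in negative degrees. *)
Definition homz A (U : set M) (k : int) (f : A U) : Prop :=
  match k with Posz j => gs_hom j f | Negz _ => f = 0 end.

Definition ksign A (U : set M) (k : int) : A U := (-1) ^+ `|k|%N.

(* ---------- charts and N-manifolds ---------- *)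

Record chart A := Chart {
  cdom : set M;
  cdim : nat;
  cgen : finType;
  cdeg : cgen -> nat;
  cx : 'I_cdim -> A cdom;
  cxi : cgen -> A cdom
}.

Definition cidx A (c : chart A) : finType := ('I_(cdim c) + cgen c)%type.

Definition qdeg A (c : chart A) (a : cidx c) : nat :=
  match a with inl _ => 0%N | inr j => cdeg j end.

Definition qco A (c : chart A) (a : cidx c) : A (cdom c) :=
  match a with inl i => cx i | inr j => cxi j end.

Definition cbody A (c : chart A) (p : M) : 'rV[R]_(cdim c) :=
  \row_i gs_ev (cx i) p.

(* Exponents of the monomials of degree k in the generators of positive degree;
   an exponent never exceeds k, and is at most 1 on odd generators. *)
Definition expon A (c : chart A) (k : nat) (e : {ffun cgen c -> 'I_k.+1}) : bool :=
  [forall j, odd (cdeg j) ==> (e j <= 1)%N] && (\sum_j e j * cdeg j == k)%N.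

Definition expand A (c : chart A) (W : set M) (k : nat)
    (a : {ffun cgen c -> 'I_k.+1} -> A W) : A W :=
  \sum_(e | expon e) a e * \prod_(j : cgen c) gs_res W (cxi j) ^+ e j.

(* c is a chart with generators of degree between 1 and n: its body is a
   homeomorphism onto an open subset of R^d that identifies degree-0 sections
   with smooth functions, and the sections are freely generated over them by
   the cxi. *)
Record is_chart (n : nat) A (c : chart A) : Prop := IsChart {
  ch_open : open (cdom c);
  ch_inj : {in cdom c &, injective (cbody c)};
  ch_cont : forall p, cdom c p -> {for p, continuous (cbody c)};
  ch_openmap : forall W, open W -> W `<=` cdom c -> open (cbody c @` W);
  ch_x_hom : forall i : 'I_(cdim c), gs_hom 0 (cx i);
  ch_smooth : forall W (g : M -> R), open W -> W `<=` cdom c ->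
    (exists f : A W, gs_hom 0 f /\ forall p, W p -> gs_ev f p = g p) <->
    (exists G : 'rV[R]_(cdim c) -> R,
       smooth_on (cbody c @` W) G /\ forall p, W p -> g p = G (cbody c p));
  ch_ev_inj : forall W (f : A W), open W -> W `<=` cdom c ->
    gs_hom 0 f -> (forall p, W p -> gs_ev f p = 0) -> f = 0;
  ch_deg : forall j : cgen c, (1 <= cdeg j <= n)%N;
  ch_xi_hom : forall j : cgen c, gs_hom (cdeg j) (cxi j);
  ch_span : forall W k (f : A W), open W -> W `<=` cdom c -> gs_hom k f ->
    exists a : {ffun cgen c -> 'I_k.+1} -> A W,
      (forall e, gs_hom 0 (a e)) /\ f = expand a;
  ch_free : forall W k (a : {ffun cgen c -> 'I_k.+1} -> A W),
    open W -> W `<=` cdom c -> (forall e, gs_hom 0 (a e)) ->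
    expand a = 0 -> forall e, expon e -> a e = 0
}.

Record Nmanifold (n : nat) A : Prop := IsNmanifold {
  nm_hausdorff : hausdorff_space M;
  nm_second_countable : @second_countable M;
  nm_charts : forall p : M, exists c : chart A, is_chart n c /\ cdom c p
}.

(* ---------- vector fields and forms ---------- *)

Definition vfield A := forall W : set M, A W -> A W.

Record is_vfield A (U : set M) (k : int) (X : vfield A) : Prop := IsVfield {
  vf_lin : forall W r (f g : A W), open W -> W `<=` U ->
    X W (gs_cst A W r * f + g) = gs_cst A W r * X W f + X W g;
  vf_hom : forall W i (f : A W), open W -> W `<=` U ->
    gs_hom i f -> homz (i%:Z + k) (X W f);
  vf_leibniz : forall W i (f g : A W), open W -> W `<=` U -> gs_hom i f ->
    X W (f * g) = X W f * g + ksign A W (k * i%:Z) * f * X W g;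
  vf_res : forall V W (f : A W), open V -> open W -> V `<=` W -> W `<=` U ->
    gs_res V (X W f) = X V (gs_res V f)
}.

Definition vf_comm A (k l : int) (X Y : vfield A) : vfield A :=
  fun W f => X W (Y W f) - ksign A W (k * l) * Y W (X W f).

Definition form1 A := forall W : set M, vfield A -> A W.

(* Forms are functionals <X, Y | w> with the form on the right (Kostant's
   convention): they are linear over functions, without sign, in the leftmost
   argument, and no sign arises from moving past the form itself. *)
Record is_form1 A (U : set M) (m : int) (b : form1 A) : Prop := IsForm1 {
  f1_hom : forall W k X, open W -> W `<=` U -> is_vfield W k X ->
    homz (k + m) (b W X);
  f1_lin : forall W i k (f : A W) X X' Z, open W -> W `<=` U -> gs_hom i f ->
    is_vfield W k X -> is_vfield W (i%:Z + k) X' -> is_vfield W (i%:Z + k) Z ->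
    (forall V h, open V -> V `<=` W -> Z V h = gs_res V f * X V h + X' V h) ->
    b W Z = f * b W X + b W X';
  f1_res : forall V W k X, open V -> open W -> V `<=` W -> W `<=` U ->
    is_vfield W k X -> gs_res V (b W X) = b V X
}.

Definition form2 A := forall W : set M, vfield A -> vfield A -> A W.

Record is_form2 A (m : int) (w : form2 A) : Prop := IsForm2 {
  f2_form1 : forall W l Y, open W -> is_vfield W l Y ->
    is_form1 W (l + m) (fun V X => w V X Y);
  f2_skew : forall W k l X Y, open W -> is_vfield W k X -> is_vfield W l Y ->
    w W X Y = - (ksign A W (k * l) * w W Y X)
}.

(* d b (X, Y), for X and Y of degrees k and l. *)
Definition dform1 A (b : form1 A) (W : set M) (k l : int) (X Y : vfield A) : A W :=
  X W (b W Y) - ksign A W (k * l) * Y W (b W X) - b W (vf_comm k l X Y).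

(* Cartan's formula for d w (X, Y, Z) = 0, up to a global sign. *)
Definition closed_form2 A (w : form2 A) : Prop :=
  forall W (k l j : int) (X Y Z : vfield A), open W ->
    is_vfield W k X -> is_vfield W l Y -> is_vfield W j Z ->
    ksign A W (k * j) * (X W (w W Y Z) - w W (vf_comm k l X Y) Z)
    + ksign A W (l * k) * (Y W (w W Z X) - w W (vf_comm l j Y Z) X)
    + ksign A W (j * l) * (Z W (w W X Y) - w W (vf_comm j k Z X) Y) = 0.

(* X |-> w (-, X) is an isomorphism from vector fields to 1-forms. *)
Definition nondegenerate A (m : int) (w : form2 A) : Prop :=
  forall U (l : int), open U ->
    (forall b : form1 A, is_form1 U l b ->
      exists X, is_vfield U (l - m) X /\
        forall W k Y, open W -> W `<=` U -> is_vfield W k Y ->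
          w W Y X = b W Y) /\
    (forall X, is_vfield U (l - m) X ->
      (forall W k Y, open W -> W `<=` U -> is_vfield W k Y -> w W Y X = 0) ->
      forall W f, open W -> W `<=` U -> X W f = 0).

Record symplectic (m : nat) A (w : form2 A) : Prop := IsSymplectic {
  sy_form : is_form2 m%:Z w;
  sy_closed : closed_form2 w;
  sy_nondeg : nondegenerate m%:Z w
}.

(* ---------- Poisson brackets, P- and QP-manifolds ---------- *)

(* {f, g} = X_f(g), where w(Y, X_f) = Y(f) for all Y. *)
Record poisson_bracket (m : nat) A (w : form2 A)
    (br : A setT -> A setT -> A setT) : Prop := IsPoissonBracket {
  pb_linl : forall r f g h,
    br (gs_cst A setT r * f + g) h = gs_cst A setT r * br f h + br g h;
  pb_linr : forall r f g h,
    br h (gs_cst A setT r * f + g) = gs_cst A setT r * br h f + br h g;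
  pb_ham : forall i f X, gs_hom i f -> is_vfield setT (i%:Z - m%:Z) X ->
    (forall W k Y, open W -> is_vfield W k Y -> w W Y X = Y W (gs_res W f)) ->
    forall g, br f g = X setT g
}.

Record P_manifold (m : nat) A (w : form2 A) (br : A setT -> A setT -> A setT) :
    Prop := IsPmanifold {
  pm_manifold : Nmanifold m A;
  pm_symplectic : symplectic m w;
  pm_bracket : poisson_bracket m w br
}.

Record QP_manifold (m : nat) A (w : form2 A) (br : A setT -> A setT -> A setT)
    (Theta : A setT) : Prop := IsQPmanifold {
  qp_P : P_manifold m w br;
  qp_deg : gs_hom m.+1 Theta;
  qp_master : br Theta Theta = 0
}.

(* ---------- shifted cotangent bundles ---------- *)

(* Morphisms of graded manifolds over the identity of M, acting by pullback. *)
Record is_gmorph (A B : gsheaf R M) (phi : forall U, A U -> B U) : Prop := IsGmorph {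
  gm_1 : forall U, open U -> phi U 1 = 1;
  gm_B : forall U f g, open U -> phi U (f - g) = phi U f - phi U g;
  gm_M : forall U f g, open U -> phi U (f * g) = phi U f * phi U g;
  gm_cst : forall U r, open U -> phi U (gs_cst A U r) = gs_cst B U r;
  gm_hom : forall U k f, open U -> gs_hom k f -> gs_hom k (phi U f);
  gm_res : forall U W f, open U -> open W -> W `<=` U ->
    phi W (gs_res W f) = gs_res W (phi U f);
  gm_ev : forall U f p, open U -> U p -> gs_ev (phi U f) p = gs_ev f p
}.

(* The chart (pi^* q^a, p_a) over the chart (q^a) of the base, where p_a has
   degree m - |q^a|. *)
Definition cot_chart (m : nat) (A B : gsheaf R M) (pi : forall U, A U -> B U) (c : chart A)
    (mom : cidx c -> B (cdom c)) : chart B :=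
  @Chart B (cdom c) (cdim c) (cgen c + cidx c)%type
    (fun j => match j with inl i => cdeg i | inr a => (m - qdeg a)%N end)
    (fun i => pi (cdom c) (cx i))
    (fun j => match j with inl i => pi (cdom c) (cxi i) | inr a => mom a end).

(* T^*[n+1]L for an N-manifold L of degree n: its body is that of L because all
   fibre coordinates p_a have positive degree.  Under a change of coordinates
   the p_a transform like the coordinate vector fields d/dq^a. *)
Record shifted_cotangent (n : nat) (L : gsheaf R M) := ShiftedCotangent {
  sc_sheaf :> gsheaf R M;
  sc_pi : forall U, L U -> sc_sheaf U;
  sc_zero : forall U, sc_sheaf U -> L U;
  sc_mom : forall c : chart L, cidx c -> sc_sheaf (cdom c);
  sc_manifold : Nmanifold n.+1 sc_sheaf;
  sc_pi_morph : is_gmorph sc_pi;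
  sc_zero_morph : is_gmorph sc_zero;
  sc_zero_pi : forall U f, open U -> sc_zero (sc_pi f) = f :> L U;
  sc_chart : forall c : chart L, is_chart n c ->
    is_chart n.+1 (cot_chart n.+1 sc_pi (@sc_mom c));
  sc_zero_mom : forall (c : chart L) (a : cidx c), is_chart n c ->
    sc_zero (sc_mom a) = 0;
  sc_transition : forall (c c' : chart L) (W : set M)
      (D : cidx c' -> vfield L),
    is_chart n c -> is_chart n c' -> open W ->
    W `<=` cdom c -> W `<=` cdom c' ->
    (forall b, is_vfield W (- (qdeg b)%:Z) (D b)) ->
    (forall b b', D b W (gs_res W (qco b')) = (b == b')%:R) ->
    forall b, gs_res W (sc_mom b) =
      \sum_(a : cidx c)
        sc_pi (D b W (gs_res W (qco a))) * gs_res W (sc_mom a)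
}.

Section Cotangent.
Variables (n : nat) (L : gsheaf R M) (T : shifted_cotangent n L).

(* w = - d theta for the Liouville form theta = p_a dq^a; thus {q, p} = 1 for
   conjugate coordinates of an ungraded cotangent bundle. *)
Definition canonical_form (w : form2 T) : Prop :=
  exists theta : form1 T, is_form1 setT n.+1%:Z theta /\
    (forall (c : chart L) W k X, is_chart n c -> open W -> W `<=` cdom c ->
      is_vfield W k X ->
      theta W X = \sum_(a : cidx c)
        X W (gs_res W (sc_pi T (qco a))) * gs_res W (sc_mom T a)) /\
    (forall W k l X Y, open W -> is_vfield W k X -> is_vfield W l Y ->
      w W X Y = - dform1 theta W k l X Y).

Definition fibre_quadratic (Theta : T setT) : Prop :=
  forall c : chart L, is_chart n c ->
    exists F : cidx c -> cidx c -> L (cdom c),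
      gs_res (cdom c) Theta =
        \sum_a \sum_b sc_pi T (F a b) * sc_mom T a * sc_mom T b.

(* Theta and the biderivation P of functions on L correspond to each other
   under the identification of bivector fields with fibrewise quadratic
   functions. *)
Definition corresponds (br : T setT -> T setT -> T setT)
    (P : L setT -> L setT -> L setT) (Theta : T setT) : Prop :=
  fibre_quadratic Theta /\
  forall f g, P f g = sc_zero (br (br (sc_pi T f) Theta) (sc_pi T g)).

Record canonical_QP_realization (brL : L setT -> L setT -> L setT)
    (w : form2 T) (br : T setT -> T setT -> T setT) (Theta : T setT) : Prop :=
    IsCanonicalQP {
  cq_QP : QP_manifold n.+1 w br Theta;
  cq_form : canonical_form w;
  cq_bivector : corresponds br brL Theta
}.

(* X is tangent to the zero section. *)
Definition tangent0 (U : set M) (X : vfield T) : Prop :=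
  forall W (h : T W), open W -> W `<=` U -> sc_zero h = 0 ->
    sc_zero (X W h) = 0.

(* The zero section is isotropic of half the dimension. *)
Definition lagrangian_zero_section (w : form2 T) : Prop :=
  (forall U k l X Y, open U -> is_vfield U k X -> is_vfield U l Y ->
     tangent0 U X -> tangent0 U Y -> sc_zero (w U X Y) = 0) /\
  (forall p : M, exists (c : chart L) (c' : chart T),
     [/\ is_chart n c, is_chart n.+1 c', cdom c p, cdom c' p &
         #|cidx c'| = (2 * #|cidx c|)%N]).

End Cotangent.

(* ---------- e^{delta_alpha} and twisted QP manifolds ---------- *)

(* Convergence of global functions of degree k: pointwise convergence of the
   coefficients in every chart. *)
Definition gs_cvg (n : nat) A (k : nat) (s : nat -> A setT) (G : A setT) : Prop :=
  [/\ forall N, gs_hom k (s N), gs_hom k G &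
   forall (c : chart A) (a : nat -> {ffun cgen c -> 'I_k.+1} -> A (cdom c))
     (b : {ffun cgen c -> 'I_k.+1} -> A (cdom c)), is_chart n c ->
     (forall N e, gs_hom 0 (a N e)) -> (forall e, gs_hom 0 (b e)) ->
     (forall N, gs_res (cdom c) (s N) = expand (a N)) ->
     gs_res (cdom c) G = expand b ->
     forall e p, expon e -> cdom c p ->
       (fun N => gs_ev (a N e) p) @ \oo --> gs_ev (b e) p].

(* G = e^{delta_alpha} F = F + {F, alpha} + 1/2 {{F, alpha}, alpha} + ...,
   for F of degree k. *)
Definition is_exp_delta (n : nat) A (br : A setT -> A setT -> A setT)
    (alpha : A setT) (k : nat) (F G : A setT) : Prop :=
  gs_cvg n k
    (fun N => \sum_(i < N)
       gs_cst A setT (i`!%:R^-1) * iter i (fun H => br H alpha) F) G.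

Definition exp_delta_vanishes (n : nat) (L : gsheaf R M)
    (T : shifted_cotangent n L) (br : T setT -> T setT -> T setT)
    (alphaL : L setT) (F : T setT) : Prop :=
  exists G : T setT,
    is_exp_delta n.+1 br (sc_pi T alphaL) n.+2 F G /\ sc_zero G = 0.

Record twisted_QP (n : nat) (L : gsheaf R M) (wL : form2 L)
    (brL : L setT -> L setT -> L setT) (alphaL : L setT) : Prop := IsTwistedQP {
  tw_P : P_manifold n wL brL;
  tw_deg : gs_hom n.+1 alphaL;
  tw_QP : exists (T : shifted_cotangent n L) (w : form2 T)
      (br : T setT -> T setT -> T setT) (Theta1 : T setT),
    [/\ QP_manifold n.+1 w br Theta1,
        lagrangian_zero_section w,
        forall f g,
          brL f g = sc_zero (br (br (sc_pi T f) Theta1) (sc_pi T g)) &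
        exp_delta_vanishes br alphaL Theta1]
}.

End GradedManifolds.

(* Main.v *)
(* Take Theta1 = Theta + Theta' on the same T^*[n+1]L.  The bracket of two
   functions of degree n + 2 is symmetric, so hypothesis 1 is half of
   {Theta1, Theta1}, since {Theta, Theta} = 0.  Hypothesis 2 says that Theta'
   does not contribute to the derived bracket.  The zero section is Lagrangian
   because the Liouville form theta = p_a dq^a vanishes along it: in
   d theta (X, Y) with X, Y tangent to it, each of the three terms restricts
   to 0. *)
Require Import Defs.
From mathcomp Require Import all_boot all_order all_algebra.
From mathcomp Require Import all_classical all_reals all_analysis.
From mathcomp Require Import zify.

Local Open Scope classical_set_scope.
Local Open Scope ring_scope.
Import GRing.Theory.

(** * Zero, sums, signs and local vanishing in a graded sheaf *)

Section GradedSheaf.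
Context {R : realType} {M : topologicalType} {A : gsheaf R M}.

Lemma gs_cst0 (U : set M) : open U -> gs_cst A U 0 = 0.
Proof. by move=> oU; rewrite -(subr0 0) gs_cstB // subrr. Qed.

Lemma gs_cstD (U : set M) a b : open U ->
  gs_cst A U (a + b) = gs_cst A U a + gs_cst A U b.
Proof.
move=> oU; rewrite -[in LHS](opprK b) -(sub0r b) !gs_cstB //.
by rewrite gs_cst0 // sub0r opprK.
Qed.

Lemma gs_res0 (U W : set M) : open U -> open W -> W `<=` U ->
  gs_res W (0 : A U) = 0.
Proof. by move=> oU oW WU; rewrite -(subr0 0) gs_resB // subrr. Qed.

Lemma gs_homD (U : set M) k (f g : A U) : open U ->
  gs_hom k f -> gs_hom k g -> gs_hom k (f + g).
Proof.
move=> oU hf hg; rewrite -[g]opprK -(sub0r g).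
by apply: gs_homB => //; apply: gs_homB => //; apply: gs_hom0.
Qed.

(** The locality axiom speaks of sections over a union, so it is applied to the family of all open
    subsets of [U] on which [f] restricts to 0; this family covers [U]. *)
Lemma gs_eq0_locally (U : set M) k (f : A U) : open U -> gs_hom k f ->
  (forall p, U p -> exists V, [/\ open V, V `<=` U, V p & gs_res V f = 0]) ->
  f = 0.
Proof.
move=> oU hf locf.
pose F : set (set M) := [set V | [/\ open V, V `<=` U & gs_res V f = 0]].
pose B := \bigcup_(V in F) V.
have oB : open B by apply: bigcup_open => V [].
have BU : B `<=` U by move=> p [V [_ VU _]] /VU.
have UB : U `<=` B by move=> p /locf[V [oV VU Vp fV]]; exists V.
have fB : gs_res B f = 0.
  apply: (@gs_local _ _ A F k) => [V []//||V FV]; first exact: gs_res_hom.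
  have [oV VU fV] := FV.
  by rewrite gs_res_comp//; exact: bigcup_sup.
(* [U] and [B] have the same points, but their sections have different types; restricting [f] to [B]
   and back to [U] recovers it. *)
by rewrite -(gs_res_id f oU) -(gs_res_comp f oU oB oU UB BU) fB gs_res0.
Qed.

Lemma homz0 (U : set M) k : open U -> homz k (0 : A U).
Proof. by move=> oU; case: k => // k; apply: gs_hom0. Qed.

Lemma homzB (U : set M) k (f g : A U) : open U ->
  homz k f -> homz k g -> homz k (f - g).
Proof.
move=> oU; case: k => k /= hf hg; first exact: gs_homB.
by rewrite hf hg subr0.
Qed.

(** With a boolean exponent, [mulr_sign] turns each Koszul sign into a choice between [f] and
    [- f]. *)
Lemma ksign_odd (U : set M) (k : int) : ksign A U k = (-1) ^+ odd `|k|%N.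
Proof. by rewrite signr_odd. Qed.

Lemma homz_ksign (U : set M) k j (f : A U) : open U ->
  homz k f -> homz k (ksign A U j * f).
Proof.
move=> oU hf; rewrite ksign_odd mulr_sign; case: ifP => // _.
by rewrite -sub0r; apply: homzB => //; apply: homz0.
Qed.

Lemma gs_res_ksign (U W : set M) j (f : A U) : open U -> open W -> W `<=` U ->
  gs_res W (ksign A U j * f) = ksign A W j * gs_res W f.
Proof.
move=> oU oW WU; rewrite !ksign_odd !mulr_sign; case: ifP => // _.
by rewrite -[in LHS]sub0r gs_resB // gs_res0 // sub0r.
Qed.

(** * Graded vector fields and their commutators *)

Section VectorField.
Context {U : set M} {k : int} {X : vfield A} (hX : is_vfield U k X).

Lemma is_vfieldS (V : set M) : V `<=` U -> is_vfield V k X.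
Proof.
move=> VU; split=> [W r f g oW WV|W i f oW WV|W i f g oW WV|V' W f oV' oW V'W WV].
- by apply: (vf_lin hX) => //; apply: subset_trans VU.
- by apply: (vf_hom hX) => //; apply: subset_trans VU.
- by apply: (vf_leibniz hX) => //; apply: subset_trans VU.
- by apply: (vf_res hX) => //; apply: subset_trans VU.
Qed.

Context {W : set M} (oW : open W) (WU : W `<=` U).

Lemma vf_add (f g : A W) : X W (f + g) = X W f + X W g.
Proof. by have := vf_lin hX 1 f g oW WU; rewrite gs_cst1 // !mul1r. Qed.

Lemma vf_0 : X W 0 = 0.
Proof. by apply: (addrI (X W 0)); rewrite -vf_add !addr0. Qed.

Lemma vf_opp (f : A W) : X W (- f) = - X W f.
Proof. by apply/eqP; rewrite -addr_eq0 -vf_add addNr vf_0. Qed.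

Lemma vf_cst r (f : A W) : X W (gs_cst A W r * f) = gs_cst A W r * X W f.
Proof. by have := vf_lin hX r f 0 oW WU; rewrite vf_0 !addr0. Qed.

Lemma vf_ksign j (f : A W) : X W (ksign A W j * f) = ksign A W j * X W f.
Proof.
by rewrite !ksign_odd !mulr_sign; case: ifP => // _; rewrite vf_opp.
Qed.

Lemma vf_homz j (f : A W) : homz j f -> homz (j + k) (X W f).
Proof.
case: j => j /= hf; first exact: (vf_hom hX).
by rewrite hf vf_0; apply: homz0.
Qed.

(** Integer degrees allow iterating the Leibniz rule: a first derivative may land in negative
    degree, where it is 0. *)
Lemma vf_leibnizz j (f g : A W) : homz j f ->
  X W (f * g) = X W f * g + ksign A W (k * j) * f * X W g.
Proof.
case: j => j /= hf; first exact: (vf_leibniz hX).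
by rewrite hf !(mul0r, mulr0, vf_0) addr0.
Qed.

End VectorField.

(** The shape of [[X, Y](f * g)] once expanded: [b] and [c] stand for the mixed terms [Y f * X g]
    and [X f * Y g], which occur in both [X Y] and [Y X]. *)
Lemma addr_cancel_cross (V : zmodType) (a b c d a' d' : V) :
  a + b + (c + d) - (a' + c + (b + d')) = a - a' + (d - d').
Proof.
rewrite [c + d]addrC [b + d']addrC addrACA [a' + c + _]addrACA [c + b]addrC.
by rewrite opprD [LHS]addrACA subrr addr0 opprD addrACA.
Qed.

Lemma odd_abszD (a b : int) : odd `|(a + b)%R|%N = odd `|a|%N (+) odd `|b|%N.
Proof. lia. Qed.

Lemma vf_comm_vfield (U : set M) (k l : int) (X Y : vfield A) :
  is_vfield U k X -> is_vfield U l Y -> is_vfield U (k + l) (vf_comm k l X Y).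
Proof.
move=> hX hY; split.
- move=> W r f g oW WU; rewrite /vf_comm.
  rewrite !(vf_add hX oW WU, vf_add hY oW WU, vf_cst hX oW WU, vf_cst hY oW WU).
  rewrite !ksign_odd !mulr_sign; case: ifP => _;
    by rewrite !(opprD, opprK, mulrDr, mulrN) addrACA.
- move=> W i f oW WU hf; rewrite /vf_comm; apply: homzB => //.
    rewrite [k + l]addrC addrA; apply: (vf_homz hX oW WU).
    exact: (vf_homz hY oW WU).
  apply: homz_ksign => //; rewrite addrA; apply: (vf_homz hY oW WU).
  exact: (vf_homz hX oW WU).
- move=> W i f g oW WU hf; rewrite /vf_comm.
  rewrite (vf_leibniz hX _ oW WU hf) (vf_leibniz hY _ oW WU hf).
  rewrite (vf_add hX oW WU) (vf_add hY oW WU) -!mulrA.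
  rewrite (vf_ksign hX oW WU) (vf_ksign hY oW WU).
  have hXf : homz (i%:Z + k) (X W f) by exact: (vf_homz hX oW WU).
  have hYf : homz (i%:Z + l) (Y W f) by exact: (vf_homz hY oW WU).
  rewrite (vf_leibnizz hX oW WU _ _ _ hYf) (vf_leibnizz hY oW WU _ _ _ hXf).
  rewrite (vf_leibniz hX _ oW WU hf) (vf_leibniz hY _ oW WU hf).
  (* All signs depend only on the parities of [k], [l] and [i]; the mixed terms cancel in each of
     the eight cases. *)
  rewrite !ksign_odd !abszM !oddM !odd_abszD !absz_nat.
  case: (odd `|k|%N); case: (odd `|l|%N); case: (odd i);
    rewrite /= ?expr0 ?expr1 !(mulrDr, mulrDl)
      !(mulN1r, mul1r, mulNr, mulrN, opprK);
    by rewrite ?addr_cancel_cross ?opprK.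
- move=> V W f oV oW VW WU; have VU := subset_trans VW WU.
  rewrite /vf_comm gs_resB // gs_res_ksign //.
  rewrite (vf_res hX _ oV oW VW WU) (vf_res hY _ oV oW VW WU).
  by rewrite (vf_res hY _ oV oW VW WU) (vf_res hX _ oV oW VW WU).
Qed.

(** * Hamiltonian vector fields and the Poisson bracket *)

(** The differential [Y |-> Y f] is a 1-form of degree [i], and the existence half of nondegeneracy
    represents it by a vector field. *)
Lemma hamiltonian_vfield (m : nat) (w : form2 A) i (f : A setT) :
  symplectic m w -> gs_hom i f ->
  exists X, is_vfield setT (i%:Z - m%:Z) X /\
    forall W k Y, open W -> is_vfield W k Y -> w W Y X = Y W (gs_res W f).
Proof.
move=> sw hf; pose df : form1 A := fun W Y => Y W (gs_res W f).
have hresf W : open W -> gs_hom i (gs_res W f).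
  by move=> oW; apply: gs_res_hom => //; exact: openT.
have hdf : is_form1 setT i%:Z df.
  split.
  - move=> W k Y oW _ hY; rewrite addrC.
    by apply: (vf_hom hY) => //; exact: hresf.
  - by move=> W j k h Y Y' Z oW _ _ _ _ _ hZ; rewrite /df hZ // gs_res_id.
  - move=> V W k Y oV oW VW _ hY; rewrite /df (vf_res hY) // gs_res_comp //.
    exact: openT.
have [[X [hX wX]] _] := let (e, u) := sy_nondeg sw i%:Z openT in conj (e _ hdf) u.
by exists X; split=> // W k Y oW hY; rewrite (wX W k).
Qed.

(** Both brackets are values of [w]: [{f, g} = X_f(g) = w(X_f, X_g)]. The sign is thus the one in
    the skewness of [w], for fields of degrees [i - m] and [j - m]. *)
Lemma poisson_bracket_skew (m : nat) (w : form2 A)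
    (br : A setT -> A setT -> A setT) i j (f g : A setT) :
  symplectic m w -> poisson_bracket m w br -> gs_hom i f -> gs_hom j g ->
  br f g = - (ksign A setT ((i%:Z - m%:Z) * (j%:Z - m%:Z)) * br g f).
Proof.
move=> sw pbr hf hg.
have [X [hX wX]] := hamiltonian_vfield _ _ _ _ sw hf.
have [Y [hY wY]] := hamiltonian_vfield _ _ _ _ sw hg.
rewrite (pb_ham pbr hf hX wX) (pb_ham pbr hg hY wY).
have := f2_skew (sy_form sw) openT hX hY.
by rewrite (wY _ _ _ openT hX) (wX _ _ _ openT hY) !gs_res_id //; exact: openT.
Qed.

Section BracketAdd.
Context {m : nat} {w : form2 A} {br : A setT -> A setT -> A setT}.
Hypothesis pbr : poisson_bracket m w br.

Lemma br_addl f g h : br (f + g) h = br f h + br g h.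
Proof.
by have := pb_linl pbr 1 f g h; rewrite gs_cst1 ?mul1r //; exact: openT.
Qed.

Lemma br_addr f g h : br h (f + g) = br h f + br h g.
Proof.
by have := pb_linr pbr 1 f g h; rewrite gs_cst1 ?mul1r //; exact: openT.
Qed.

End BracketAdd.

(* In degree [m + 1] both hamiltonian vector fields are odd, so the bracket is
   symmetric and the mixed terms add up. *)
Lemma master_equation_add (m : nat) (w : form2 A)
    (br : A setT -> A setT -> A setT) (f g : A setT) :
  symplectic m w -> poisson_bracket m w br ->
  gs_hom m.+1 f -> gs_hom m.+1 g -> br f f = 0 ->
  br f g + gs_cst A setT 2^-1 * br g g = 0 -> br (f + g) (f + g) = 0.
Proof.
move=> sw pbr hf hg ff0 fg0.
have gf : br g f = br f g.
  rewrite (poisson_bracket_skew _ _ _ _ _ _ _ sw pbr hg hf).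
  have -> : m.+1%:Z - m%:Z = 1 by lia.
  by rewrite mulr1 ksign_odd expr1 mulN1r opprK.
rewrite !(br_addl pbr, br_addr pbr) ff0 add0r gf.
(* Splitting [{g, g}] into two halves exhibits the sum as twice the left-hand side of the
   hypothesis. *)
have -> : br g g = gs_cst A setT 2 * (gs_cst A setT 2^-1 * br g g).
  rewrite mulrA -gs_cstM ?divff ?gs_cst1 ?mul1r ?pnatr_eq0 //; exact: openT.
rewrite -[in gs_cst A setT 2]/(1 + 1) gs_cstD ?gs_cst1; try exact: openT.
by rewrite mulrDl mul1r addrA addrACA fg0 addr0.
Qed.

End GradedSheaf.

(** * Additivity of morphisms of graded manifolds *)

Section Morphism.
Context {R : realType} {M : topologicalType} {A B : gsheaf R M}.
Context {phi : forall U, A U -> B U} (hphi : is_gmorph phi).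
Context {U : set M} (oU : open U).

Lemma gmorph0 : phi U 0 = 0.
Proof. by rewrite -(subr0 0) (gm_B hphi) // subrr. Qed.

Lemma gmorphD (f g : A U) : phi U (f + g) = phi U f + phi U g.
Proof.
by rewrite -[in LHS](opprK g) -(sub0r g) !(gm_B hphi) // gmorph0 sub0r opprK.
Qed.

Lemma gmorph_ksign j (f : A U) : phi U (ksign A U j * f) = ksign B U j * phi U f.
Proof.
rewrite !ksign_odd !mulr_sign; case: ifP => // _.
by rewrite -[in LHS]sub0r (gm_B hphi) // gmorph0 sub0r.
Qed.

End Morphism.

(** * The zero section is Lagrangian *)

Section ZeroSection.
Context {R : realType} {M : topologicalType} {n : nat} {L : gsheaf R M}.
Context {T : shifted_cotangent n L}.
Hypothesis nmL : Nmanifold n L.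

Let zm : is_gmorph (@sc_zero _ _ _ _ T) := sc_zero_morph T.

(** Over a chart, every summand of [theta] carries a momentum factor, which restricts to 0; charts
    cover [M], so local vanishing suffices. *)
Lemma liouville_zero_section (theta : form1 T) :
  is_form1 setT n.+1%:Z theta ->
  (forall (c : chart L) W k X, is_chart n c -> open W -> W `<=` cdom c ->
     is_vfield W k X ->
     theta W X = \sum_(a : cidx c)
       X W (gs_res W (sc_pi T (qco a))) * gs_res W (sc_mom T a)) ->
  forall W k X, open W -> is_vfield W k X -> sc_zero (theta W X) = 0.
Proof.
move=> f1theta thetaE W k X oW hX.
have := f1_hom f1theta oW (@subsetT _ _) hX.
case: (k + n.+1%:Z)%R => [j /= hj|j /= ->]; last exact: (gmorph0 zm).
apply: (gs_eq0_locally _ j _ oW (gm_hom zm oW hj)) => p Wp.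
have [c [hc cp]] := nm_charts nmL p.
have oc := ch_open hc.
pose V := W `&` cdom c.
have oV : open V by exact: openI.
have VW : V `<=` W by move=> ? [].
have Vc : V `<=` cdom c by move=> ? [].
exists V; split=> //.
rewrite -(gm_res zm) // (f1_res f1theta oV oW VW (@subsetT _ _) hX).
rewrite (thetaE _ _ _ _ hc oV Vc (is_vfieldS hX V VW)).
elim/big_rec: _ => [|a x _ IH]; first exact: (gmorph0 zm).
rewrite (gmorphD zm oV) IH addr0 (gm_M zm) // (gm_res zm _ oc oV Vc).
by rewrite sc_zero_mom // gs_res0 // mulr0.
Qed.

Lemma canonical_lagrangian (w : form2 T) :
  canonical_form w -> lagrangian_zero_section w.
Proof.
move=> [theta [f1theta [thetaE wE]]]; split=> [U k l X Y oU hX hY tX tY|p].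
  have theta0 := liouville_zero_section _ f1theta thetaE.
  rewrite (wE _ _ _ _ _ oU hX hY) /dform1 -sub0r.
  rewrite !(gm_B zm) // (gmorph0 zm) // (gmorph_ksign zm) //.
  rewrite (theta0 _ _ _ oU (vf_comm_vfield _ _ _ _ _ hX hY)).
  (* [theta] of [X] and of [Y] vanish on the zero section, and tangent fields preserve such
     functions. *)
  rewrite (tX U) ?(tY U) ?(theta0 _ _ _ oU hX) ?(theta0 _ _ _ oU hY) //.
  by rewrite mulr0 !subr0.
have [c [hc cp]] := nm_charts nmL p.
exists c, (cot_chart n.+1 (sc_pi T) (@sc_mom _ _ _ _ T c)); split=> //.
  exact: sc_chart.
(* The cotangent chart keeps the base coordinates and adds one momentum for each, those conjugate to
   degree-0 coordinates included. *)
by rewrite /cidx /= !card_sum !card_ord mul2n -addnn addnA.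
Qed.

End ZeroSection.

Theorem proposition5p2 (R : realType) (M : topologicalType) (n : nat)
    (L : gsheaf R M) (wL : form2 L) (brL : L setT -> L setT -> L setT)
    (hL : P_manifold n wL brL)
    (T : shifted_cotangent n L) (w : form2 T)
    (br : T setT -> T setT -> T setT) (Theta : T setT)
    (hcan : canonical_QP_realization brL w br Theta)
    (Theta' : T setT) (hTheta' : gs_hom n.+2 Theta')
    (alphaL : L setT) (halphaL : gs_hom n.+1 alphaL)
    (h1 : br Theta Theta' + gs_cst T setT 2^-1 * br Theta' Theta' = 0)
    (h2 : forall f g : L setT,
      sc_zero (br (br (sc_pi T f) Theta') (sc_pi T g)) = 0)
    (h3 : exp_delta_vanishes br alphaL (Theta + Theta')) :
  twisted_QP n wL brL alphaL.
Proof.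
have [qp wcan [_ brLE]] := hcan.
have [[nmT sw pbr] hTheta master] := qp.
(* The exponential condition for this witness is [h3] itself; the master equation, the Lagrangian
   condition and the derived bracket remain. *)
split=> //; exists T, w, br, (Theta + Theta'); split=> //.
- split; first exact: (qp_P qp).
    by apply: gs_homD => //; exact: openT.
  exact: (master_equation_add _ _ _ _ _ sw pbr).
- exact: canonical_lagrangian (pm_manifold hL) _ wcan.
- move=> f g; rewrite brLE (br_addr pbr) (br_addl pbr).
  by rewrite (gmorphD (sc_zero_morph T) openT) h2 addr0.
Qed.
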